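(* Let $\mathcal X=\{\mathcal X_n\}$ be a prior supported on the unit sphere in $\mathbb R^n$ and with exponential support: $$\limsup_{n\to\infty}\frac1n\log|\operatorname{supp}\mathcal X_n|=c.$$ For any $d\ge2$, when $\lambda>2\sqrt c$, there exists a hypothesis test distinguishing $\mathrm{WT}(d,\lambda,\mathcal X)$ from $\mathrm{WT}(d)$ with probability $o(1)$ of error as $n\to\infty$ (i.e. strong detection is possible), and furthermore there exists an estimator that achieves nontrivial correlation with the spike (i.e. weak recovery is possible).
   Context: Wigner tensor: for integers $d\ge2$, $n\ge1$, $\mathrm{WT}(d)=\mathrm{WT}_n(d)$ is the law of the symmetric tensor $W\in(\mathbb R^n)^{\otimes d}$ obtained by drawing $W'\in\mathbb R^{n^d}$ with i.i.d. $\mathcal N(0,2/n)$ entries and averaging it over all $d!$ permutations of the indices. Spiked model: a prior $\mathcal X=\{\mathcal X_n\}$ is a family of distributions on unit vectors of $\mathbb R^n$; for $\lambda\ge0$ not depending on $n$, $\mathrm{WT}(d,\lambda,\mathcal X)$ is the law of $T=\lambda x^{\otimes d}+W$ with $x\sim\mathcal X_n$ and $W\sim\mathrm{WT}_n(d)$ independent. Here $\mathcal X_n$ has finite support and $c<\infty$. Strong detection: given a single sample from either $\mathrm{WT}(d,\lambda,\mathcal X)$ or $\mathrm{WT}(d)$, each chosen with probability $1/2$, decide which one with success probability $1-o(1)$ as $n\to\infty$. Weak recovery: given a sample $T$ from $\mathrm{WT}(d,\lambda,\mathcal X)$, output a unit vector $\hat x=\hat x(T)$ with $\mathbb E[\langle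 x,\hat x\rangle^d]\ge\varepsilon$ as $n\to\infty$, for some $\varepsilon>0$ not depending on $n$. There is no computational restriction. *)

(* Defs.v *)
From HB Require Import structures.
From mathcomp Require Import all_boot all_order all_fingroup all_algebra.
From mathcomp Require Import finmap.
From mathcomp Require Import all_classical all_reals all_analysis.
From mathcomp Require Import measurable_realfun.

Set Implicit Arguments.
Unset Strict Implicit.
Unset Printing Implicit Defensive.

Import Order.TTheory GRing.Theory Num.Theory.
Import numFieldNormedType.Exports.

Local Open Scope classical_set_scope.
Local Open Scope ring_scope.

(* Vectors and tensors are tuples because tuples carry the product            *)
(* sigma-algebra of their coordinates, i.e. the Borel sigma-algebra here.     *)
Notation vec R n := (n.-tuple (R : Type)).

Notation mindex d n := {ffun 'I_d -> 'I_n}.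

(* (R^n)^{\otimes d}: the n^d entries, listed in the order of enum.           *)
Notation tensor R d n := (#|{: mindex d n}|.-tuple (R : Type)).

Section linear_algebra.
Context {R : realType}.

Definition dot n (x y : vec R n) : R := \sum_(i < n) tnth x i * tnth y i.

Definition norm2 n (x : vec R n) : R := Num.sqrt (dot x x).

Definition entry d n (T : tensor R d n) (i : mindex d n) : R :=
  tnth T (enum_rank i).

Definition mktensor d n (f : mindex d n -> R) : tensor R d n :=
  [tuple f (enum_val k) | k < #|{: mindex d n}|].

Definition tpow d n (x : vec R n) : tensor R d n :=
  mktensor (fun i : mindex d n => \prod_(k < d) tnth x (i k)).

Definition symmetrize d n (W : tensor R d n) : tensor R d n :=
  mktensor (fun i : mindex d n =>
    (d`!%:R)^-1 * \sum_(s : 'S_d) entry W [ffun k => i (s k)]).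

Definition spike d n (lambda : R) (x : vec R n) (W : tensor R d n) :
    tensor R d n :=
  mktensor (fun i : mindex d n => lambda * entry (tpow d x) i + entry W i).

Lemma entry_mktensor d n (f : mindex d n -> R) i : entry (mktensor f) i = f i.
Proof. by rewrite /entry tnth_mktuple enum_rankK. Qed.

Lemma measurable_entry d n (i : mindex d n) :
  measurable_fun [set: tensor R d n] (fun T => entry T i).
Proof. exact: measurable_tnth. Qed.

Lemma measurable_mktensor d0 (A : measurableType d0) d n
    (f : A -> mindex d n -> R) :
  (forall i, measurable_fun [set: A] (f ^~ i)) ->
  measurable_fun [set: A] (fun a => mktensor (f a)).
Proof.
move=> mf; apply/measurable_fun_tnthP => k.
rewrite (_ : _ \o _ = f ^~ (enum_val k)) //.
by apply/funext => a /=; rewrite tnth_mktuple.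
Qed.

Lemma measurable_tpow d n : measurable_fun [set: vec R n] (@tpow d n).
Proof.
apply: measurable_mktensor => i.
by apply: measurable_prod => k _; exact: measurable_tnth.
Qed.

Lemma measurable_symmetrize d n :
  measurable_fun [set: tensor R d n] (@symmetrize d n).
Proof.
apply: measurable_mktensor => i; apply: measurable_funM => //.
by apply: measurable_sum => s; exact: measurable_entry.
Qed.

Lemma measurable_spike d n (lambda : R) :
  measurable_fun [set: (vec R n * tensor R d n)%type]
    (fun p => spike lambda p.1 p.2).
Proof.
apply: measurable_mktensor => i; apply: measurable_funD.
  apply: measurable_funM => //.
  apply: (measurableT_comp (f := fun T : tensor R d n => entry T i)).
    exact: measurable_entry.
  by apply: measurableT_comp; [exact: measurable_tpow|exact: measurable_fst].
apply: (measurableT_comp (f := fun T : tensor R d n => entry T i)).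
  exact: measurable_entry.
exact: measurable_snd.
Qed.

Lemma measurable_signal_sample d n (lambda : R) :
  measurable_fun [set: (vec R n * tensor R d n)%type]
    (fun p => (p.1, spike lambda p.1 p.2)).
Proof.
by apply: measurable_fun_pair; [exact: measurable_fst|exact: measurable_spike].
Qed.

HB.instance Definition _ d n :=
  isMeasurableFun.Build _ _ _ _ (@symmetrize d n) (@measurable_symmetrize d n).

Definition signal_sample d n (lambda : R) (p : vec R n * tensor R d n) :
  vec R n * tensor R d n := (p.1, spike lambda p.1 p.2).

HB.instance Definition _ d n lambda :=
  isMeasurableFun.Build _ _ _ _ (@signal_sample d n lambda)
    (@measurable_signal_sample d n lambda).

End linear_algebra.

HB.instance Definition _ d1 d2 (T1 : measurableType d1) (T2 : measurableType d2) :=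
  isMeasurableFun.Build _ _ _ _ (@snd T1 T2) (@measurable_snd d1 d2 T1 T2).

Section iid.
Context {R : realType} d (T : measurableType d).

Definition tcons n (p : T * n.-tuple T) : n.+1.-tuple T :=
  [tuple of p.1 :: p.2].

Lemma measurable_tcons n : measurable_fun [set: (T * n.-tuple T)%type] (@tcons n).
Proof. by apply: measurable_cons. Qed.

HB.instance Definition _ n :=
  isMeasurableFun.Build _ _ _ _ (@tcons n) (@measurable_tcons n).

(* The n-fold product law P \x ... \x P. *)
Fixpoint iid (P : probability T R) n : probability (n.-tuple T) R :=
  if n is m.+1 then distribution (P \x iid P m)%E (@tcons m)
  else dirac [tuple].

End iid.

Section models.
Context {R : realType}.

(* The identity between the two (convertible) copies of the Borel             *)
(* sigma-algebra of R: the one normal_prob is stated with, and the canonical  *)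
(* one.                                                                       *)
Definition borel_id (x : measurableTypeR R) : R := x.

Lemma measurable_borel_id : measurable_fun [set: measurableTypeR R] borel_id.
Proof. exact: (@measurable_id _ _ setT). Qed.

HB.instance Definition _ :=
  isMeasurableFun.Build _ _ _ _ borel_id measurable_borel_id.

(* normal_prob takes the standard deviation as parameter. *)
Definition gaussian (variance : R) : probability R R :=
  distribution (normal_prob 0 (Num.sqrt variance)) borel_id.

Definition gaussian_noise d n : probability (tensor R d n) R :=
  iid (gaussian (2 / n%:R)) #|{: mindex d n}|.

Definition WT d n : probability (tensor R d n) R :=
  distribution (gaussian_noise d n) (@symmetrize R d n).

(* The joint law of (x, T) with T = lambda x^{\otimes d} + W, where x and W   *)
(* are independent of laws mu and WT d n.                                     *)
Definition spiked_joint d n (lambda : R) (mu : probability (vec R n) R) :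
    probability (vec R n * tensor R d n)%type R :=
  distribution (mu \x WT d n)%E (@signal_sample R d n lambda).

Definition spiked_WT d n (lambda : R) (mu : probability (vec R n) R) :
    probability (tensor R d n) R :=
  distribution (spiked_joint d lambda mu) snd.

Definition supp n (mu : probability (vec R n) R) : set (vec R n) :=
  [set x | (0 < mu [set x])%E].

(* supp is the set of atoms, hence the requirement that it has full mass.     *)
Definition finitely_supported n (mu : probability (vec R n) R) : Prop :=
  finite_set (supp mu) /\ mu (supp mu) = 1%E.

Definition supp_size n (mu : probability (vec R n) R) : nat :=
  #|` fset_set (supp mu)|%fset.

(* There is no unit vector in R^0, whence the restriction to n > 0.           *)
Definition finite_prior (X : forall n, probability (vec R n) R) : Prop :=
  forall n, (0 < n)%N -> finitely_supported (X n) /\ supp (X n) `<=` [set x | norm2 x = 1].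

(* The test answers true for Q; each of P n and Q n has probability 1/2.      *)
Definition strong_detection (dd : nat -> measure_display)
    (S : forall n, measurableType (dd n))
    (P Q : forall n, probability (S n) R) : Prop :=
  exists2 test : forall n, S n -> bool,
    forall n, measurable_fun [set: S n] (test n) &
    (fun n => 2^-1%:E * P n [set t | test n t = true] +
              2^-1%:E * Q n [set t | test n t = false])%E @ \oo --> 0%E.

Definition weak_recovery d (lambda : R)
    (X : forall n, probability (vec R n) R) : Prop :=
  exists xhat : forall n, tensor R d n -> vec R n,
    (forall n, measurable_fun [set: tensor R d n] (xhat n)) /\
    (forall n T, (0 < n)%N -> norm2 (xhat n T) = 1) /\
    exists2 eps : R, 0 < eps &
      \forall n \near \oo,
        (eps%:E <= 'E_(spiked_joint d lambda (X n))
                      [fun p => (dot p.1 (xhat n p.2) ^+ d)%R])%E.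

End models.

(* Main.v *)
Require Import Defs.
From HB Require Import structures.
From mathcomp Require Import all_boot all_order all_fingroup all_algebra.
From mathcomp Require Import finmap ring lra.
From mathcomp Require Import all_classical all_reals all_analysis.
From mathcomp Require Import measurable_realfun.

Set Implicit Arguments.
Unset Strict Implicit.
Unset Printing Implicit Defensive.

Import Order.TTheory GRing.Theory Num.Theory.
Import numFieldNormedType.Exports.

Local Open Scope classical_set_scope.
Local Open Scope ring_scope.

(* For a unit vector v, <v^{(x)d}, W> has law N(0, 2/n), hence exceeds s with *)
(* probability at most exp(-n s^2/4).  Fix 2 sqrt c < s < t < lambda.  By a   *)
(* union bound over the support, of size exp(n(c + o(1))), with high          *)
(* probability no v in the support has <v^{(x)d}, W> >= s, whereas for the    *)
(* true spike x one has <x^{(x)d}, T> = lambda + <x^{(x)d}, W> >= t.  The     *)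
(* test asks whether some v in the support has <v^{(x)d}, T> >= t, and the    *)
(* estimator returns the first such v: it satisfies                           *)
(* t <= lambda <x, v>^d + <v^{(x)d}, W> < lambda <x, v>^d + s.                *)

(** Testing all support vectors at once works because the exponential size of the support is beaten
    by the Gaussian tail exactly above [2 * Num.sqrt c]: the union bound over exp(n(c + o(1)))
    vectors costs exp(n(c - s^2/4 + o(1))), and c < s^2/4 once s > 2 sqrt c. The tail of <v^{(x)d},
    W> comes from the moment generating function of a linear form in i.i.d. Gaussians
    ([iid_gaussian_tail]), because pairing with a symmetric tensor ignores symmetrization
    ([dot_tpow_symmetrize]). [WT_max_tail] is the union bound, [first_hit_correlated] the
    deterministic argument for the estimator. For weak recovery, high probability is turned into
    expectation: the overlap is at least a = (t - s)/lambda outside an event of probability at most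
    err_n, and at least -1 everywhere, so its mean is at least a - (1 + a) err_n ([expectation_ge]),
    with err_n tending to 0 ([cvg_error_bound]). *)

Section gaussian_tail.
Context {R : realType}.

(** The density and the Radon-Nikodym derivative have the same integral over every measurable set,
    hence agree almost everywhere. *)
Lemma ge0_integral_normal_prob (m s : R) (f : R -> \bar R) :
  measurable_fun [set: R] f -> (forall x, 0 <= f x)%E ->
  (\int[normal_prob m s]_x f x =
   \int[lebesgue_measure]_x (f x * (normal_pdf m s x)%:E))%E.
Proof.
move=> mf f0.
have dom := normal_prob_dominates m s.
rewrite -(Radon_Nikodym_SigmaFinite.change_of_variables dom f0)//.
apply: ae_eq_integral => //.
- apply: emeasurable_funM => //.
  exact: measurable_int (Radon_Nikodym_SigmaFinite.f_integrable dom).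
- apply: emeasurable_funM => //; apply/measurable_EFinP.
  exact: measurable_normal_pdf.
- apply: ae_eqe_mul2l; apply: integral_ae_eq => //.
  + exact: Radon_Nikodym_SigmaFinite.f_integrable.
  + by apply/measurable_EFinP; exact: measurable_normal_pdf.
  + by move=> E _ mE; rewrite -Radon_Nikodym_SigmaFinite.f_integral.
Qed.

(** Tilting the density of N(0, v) by exp(a x) gives a constant times the density of N(a v, v),
    which integrates to 1. *)
Lemma gaussian_mgf (v a : R) : 0 < v ->
  (\int[gaussian v]_x (expR (a * x))%:E = (expR (a ^+ 2 * v / 2))%:E)%E.
Proof.
move=> v0; have s0 : Num.sqrt v != 0 by rewrite gt_eqF// sqrtr_gt0.
have mexp : measurable_fun [set: R] (fun x : R => (expR (a * x))%:E).
  by apply/measurable_EFinP; apply: measurableT_comp.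
rewrite ge0_integral_distribution//.
rewrite [LHS](ge0_integral_normal_prob 0 (Num.sqrt v) mexp); last first.
  by move=> x; rewrite lee_fin expR_ge0.
transitivity (\int[lebesgue_measure]_x ((expR (a ^+ 2 * v / 2))%:E *
    (normal_pdf (a * v) (Num.sqrt v) x)%:E))%E.
  apply: eq_integral => x _; rewrite !normal_pdfE// -!EFinM; congr EFin.
  (* completing the square in the exponent *)
  rewrite mulrCA [RHS]mulrCA; congr (_ * _).
  rewrite /normal_fun -!expRD sqr_sqrtr ?ltW//; congr expR.
  by field; rewrite gt_eqF.
rewrite ge0_integralZl//; last by move=> x _; rewrite lee_fin normal_pdf_ge0.
  by rewrite integral_normal_pdf mule1.
by apply/measurable_EFinP; exact: measurable_normal_pdf.
Qed.

Definition lin_form N (a : 'I_N -> R) (w : vec R N) : R :=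
  \sum_(i < N) a i * tnth w i.

Lemma measurable_lin_form N (a : 'I_N -> R) :
  measurable_fun [set: vec R N] (lin_form a).
Proof.
by apply: measurable_sum => i; apply: measurable_funM => //;
  exact: measurable_tnth.
Qed.

(** Induction on [N]: Tonelli splits off the first coordinate, and the exponential of the sum
    factors. *)
Lemma iid_gaussian_mgf (v : R) N (a : 'I_N -> R) : 0 < v ->
  (\int[iid (gaussian v) N]_w (expR (lin_form a w))%:E =
   (expR ((\sum_i a i ^+ 2) * v / 2))%:E)%E.
Proof.
move=> v0.
have mexp n (b : 'I_n -> R) :
    measurable_fun [set: vec R n] (fun w => (expR (lin_form b w))%:E).
  by apply/measurable_EFinP; apply: measurableT_comp => //;
    exact: measurable_lin_form.
elim: N a => [|N IH] a /=.
  rewrite integral_dirac//= ?diracT ?mul1e; last exact: mexp.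
  by rewrite /lin_form !big_ord0 !mul0r.
have mtc : measurable_fun [set: (R * N.-tuple (R : Type))%type]
    (fun p => (expR (lin_form a (tcons p)))%:E).
  apply: (@measurableT_comp _ _ _ _ _ _ (fun w => (expR (lin_form a w))%:E)).
    exact: mexp.
  exact: measurable_tcons.
rewrite ge0_integral_distribution; [|exact: mexp|by move=> w; rewrite lee_fin expR_ge0].
rewrite fubini_tonelli1; [|exact: mtc|by move=> w; rewrite lee_fin expR_ge0].
rewrite /fubini_F.
have linE x w : lin_form a (tcons (x, w)) =
    a ord0 * x + lin_form (fun i : 'I_N => a (lift ord0 i)) w.
  rewrite /lin_form big_ord_recl tnth0; congr (_ + _).
  by apply: eq_bigr => i _; rewrite tnthS.
transitivity (\int[gaussian v]_x ((expR (a ord0 * x))%:E *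
   (expR ((\sum_i a (lift ord0 i) ^+ 2) * v / 2))%:E))%E.
  apply: eq_integral => x _.
  under eq_integral => w _ do rewrite /= linE expRD EFinM.
  rewrite ge0_integralZl//; last exact: mexp.
  congr (_ * _)%E; exact: IH.
rewrite ge0_integralZr//; last by apply/measurable_EFinP; apply: measurableT_comp.
rewrite gaussian_mgf// -EFinM -expRD; congr (expR _)%:E.
by rewrite [in RHS]big_ord_recl; ring.
Qed.

Lemma iid_gaussian_tail (v s : R) N (a : 'I_N -> R) :
  0 < v -> 0 < s -> \sum_i a i ^+ 2 = 1 ->
  (iid (gaussian v) N [set w | (s <= lin_form a w)%R] <=
   (expR (- (s ^+ 2 / (2 * v))))%:E)%E.
Proof.
move=> v0 s0 a1.
pose X : {RV (iid (gaussian v) N) >-> R} :=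
  HB.pack (lin_form a) (isMeasurableFun.Build _ _ _ _ _ (measurable_lin_form a)).
(* The Chernoff exponent r^2 v / 2 - r s is minimal at r = s / v. *)
have r0 : 0 < s / v by rewrite divr_gt0.
apply: (le_trans (chernoff X s r0)).
rewrite /mmt_gen_fun unlock.
have -> : (\int[iid (gaussian v) N]_w ((expR \o (s / v) \o* X) w)%:E =
  \int[iid (gaussian v) N]_w (expR (lin_form (fun i => (s / v) * a i) w))%:E)%E.
  apply: eq_integral => w _; congr (expR _)%:E => /=.
  by rewrite mulrC /lin_form mulr_sumr; apply: eq_bigr => i _; rewrite mulrA.
rewrite iid_gaussian_mgf// -EFinM -expRD lee_fin ler_expR.
under eq_bigr do rewrite exprMn.
rewrite -mulr_sumr a1 le_eqVlt; apply/orP; left; apply/eqP.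
by field; rewrite gt_eqF.
Qed.

End gaussian_tail.

(** * Inner products of tensor powers *)

Section tensor_algebra.
Context {R : realType}.
Variables d n : nat.
Implicit Types (x y v : vec R n) (W T : tensor R d n).

Lemma dot_entry T W :
  dot T W = \sum_(i : mindex d n) entry T i * entry W i.
Proof.
rewrite /dot (reindex (@enum_rank (mindex d n)))//=.
by exists enum_val => i _; rewrite ?enum_rankK ?enum_valK.
Qed.

Lemma dot_tpow x y : dot (tpow d x) (tpow d y) = dot x y ^+ d.
Proof.
rewrite dot_entry /dot -[in RHS](card_ord d) -prodr_const.
rewrite (bigA_distr_bigA (fun _ j => tnth x j * tnth y j))/=.
by apply: eq_bigr => i _; rewrite !entry_mktensor big_split.
Qed.

Lemma dot_tpow_spike (lambda : R) v x W :
  dot (tpow d v) (spike lambda x W) =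
  lambda * dot v x ^+ d + dot (tpow d v) W.
Proof.
rewrite -dot_tpow !dot_entry mulr_sumr -big_split/=.
by apply: eq_bigr => i _; rewrite [entry (spike _ _ _) i]entry_mktensor; ring.
Qed.

Lemma entry_tpow_perm (s : 'S_d) v (i : mindex d n) :
  entry (tpow d v) [ffun k => i (s k)] = entry (tpow d v) i.
Proof.
rewrite !entry_mktensor [RHS](reindex_inj (@perm_inj _ s)).
by apply: eq_bigr => k _; rewrite ffunE.
Qed.

(** A permutation of the d positions can be moved from [W] to [tpow d v], which it fixes; so all d!
    terms of the average coincide. This reduces the Wigner noise to the i.i.d. noise. *)
Lemma dot_tpow_symmetrize v W :
  dot (tpow d v) (symmetrize W) = dot (tpow d v) W.
Proof.
rewrite dot_entry; under eq_bigr do rewrite [entry (symmetrize W) _]entry_mktensor.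
transitivity ((d`!%:R)^-1 * \sum_(s : 'S_d) dot (tpow d v) W); last first.
  by rewrite sumr_const card_Sn -[X in _ * X]mulr_natl mulKf//.
under eq_bigr do rewrite mulrCA mulr_sumr.
rewrite -mulr_sumr exchange_big/=; congr (_ * _); apply: eq_bigr => s _.
rewrite dot_entry [RHS](reindex (fun i : mindex d n => [ffun k => i (s k)]))/=.
  by apply: eq_bigr => i _; rewrite entry_tpow_perm.
exists (fun i : mindex d n => [ffun k => i ((s^-1)%g k)]) => i _;
  by apply/ffunP => k; rewrite !ffunE ?permK ?permKV.
Qed.

Lemma norm2_eq1 x : norm2 x = 1 -> dot x x = 1.
Proof.
move=> x1; rewrite -[LHS]sqr_sqrtr; last by apply: sumr_ge0 => i _; exact: sqr_ge0.
by rewrite -[Num.sqrt _]/(norm2 x) x1 expr1n.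
Qed.

Lemma dot_unit_le1 x y : dot x x = 1 -> dot y y = 1 -> `|dot x y| <= 1.
Proof.
move=> x1 y1.
have sq (e : R) : 0 <= dot x x + e * dot x y *+ 2 + e ^+ 2 * dot y y.
  rewrite /dot mulr_sumr -sumrMnl mulr_sumr -!big_split/=.
  apply: sumr_ge0 => i _.
  rewrite [leRHS](_ : _ = (tnth x i + e * tnth y i) ^+ 2) ?sqr_ge0//.
  by ring.
(* The two inequalities say that x + y and x - y have nonnegative squared norm. *)
have := sq 1; have := sq (-1); rewrite x1 y1 ler_norml; lra.
Qed.

End tensor_algebra.

(** * The scan test and the first-hit estimator *)

Section scan.
Context {R : realType}.
Variables d n : nat.
Implicit Types (l : seq (vec R n)) (W T : tensor R d n).

Definition scan_test l (t : R) T : bool :=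
  has (fun v => t <= dot (tpow d v) T) l.

(** The value is [x0] when no candidate reaches [t]. The fold lets measurability follow by induction
    on [l]. *)
Definition first_hit (x0 : vec R n) l (t : R) T : vec R n :=
  foldr (fun v x => if t <= dot (tpow d v) T then v else x) x0 l.

Lemma measurable_dot N (a : vec R N) : measurable_fun [set: vec R N] (dot a).
Proof. exact: measurable_lin_form. Qed.

Lemma measurable_dot_ge N (a : vec R N) (s : R) :
  measurable [set w : vec R N | s <= dot a w].
Proof.
have := measurable_dot a measurableT (measurable_itv `[s, +oo[).
by rewrite setTI; congr measurable; apply/seteqP; split=> w /=;
  rewrite in_itv/= andbT.
Qed.

Lemma measurable_dot_le (v : vec R n) (s : R) :
  measurable [set W : tensor R d n | dot (tpow d v) W <= s].
Proof.
have := measurable_dot (tpow d v) measurableT (measurable_itv `]-oo, s]).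
by rewrite setTI; congr measurable; apply/seteqP; split=> w /=; rewrite in_itv.
Qed.

Lemma measurable_ge_dot (v : vec R n) (t : R) :
  measurable_fun [set: tensor R d n] (fun T => t <= dot (tpow d v) T).
Proof.
by apply: (measurable_fun_bool true); rewrite setTI; exact: measurable_dot_ge.
Qed.

Lemma measurable_scan_test l (t : R) :
  measurable_fun [set: tensor R d n] (scan_test l t).
Proof.
elim: l => [|v l IH]; first exact: measurable_cst.
by apply: measurable_or => //; exact: measurable_ge_dot.
Qed.

Lemma measurable_first_hit x0 l (t : R) :
  measurable_fun [set: tensor R d n] (first_hit x0 l t).
Proof.
elim: l => [|v l IH]; first exact: measurable_cst.
by apply: measurable_fun_ifT => //; exact: measurable_ge_dot.
Qed.

Lemma mem_first_hit x0 l (t : R) T : x0 \in l -> first_hit x0 l t T \in l.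
Proof.
suff H : first_hit x0 l t T \in x0 :: l.
  by move=> x0l; move: H; rewrite inE => /orP[/eqP->|].
elim: l => [|v l IH]; first exact: mem_head.
rewrite /=; case: ifP => _; first by rewrite !inE eqxx orbT.
by move: IH; rewrite !inE => /orP[->|->]//; rewrite !orbT.
Qed.

Lemma first_hitP x0 l (t : R) T : scan_test l t T ->
  first_hit x0 l t T \in l /\ t <= dot (tpow d (first_hit x0 l t T)) T.
Proof.
elim: l => [//|v l IH] /=; case: ifP => [vT _|_ /= /IH[ml lT]].
  by rewrite mem_head.
by rewrite inE ml orbT.
Qed.

(** The spike itself reaches level [t], so the returned v is a genuine hit; its noise part is below
    [s], so the signal part lambda <v, x>^d must exceed t - s. Here [scan_test l s] is applied to
    the pure noise and describes a bad event. *)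
Lemma first_hit_correlated x0 l (lambda t s : R) (x : vec R n) W :
  0 < lambda -> x \in l -> dot x x = 1 ->
  ~~ (dot (tpow d x) W <= - (lambda - t)) -> ~~ scan_test l s W ->
  (t - s) / lambda <=
    dot x (first_hit x0 l t (spike lambda x W)) ^+ d.
Proof.
move=> lambda0 xl x1; rewrite -ltNge => xW /hasPn sW.
have hit : scan_test l t (spike lambda x W).
  by apply/hasP; exists x => //; rewrite dot_tpow_spike x1 expr1n; lra.
have [vl] := first_hitP x0 hit.
move: (first_hit _ _ _ _) vl => v vl.
rewrite dot_tpow_spike => tv; have := sW _ vl; rewrite -ltNge => vs.
rewrite ler_pdivrMr// [dot x v](_ : _ = dot v x); first by lra.
by apply: eq_bigr => i _; rewrite mulrC.
Qed.

End scan.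

(** * Tails of the Wigner noise and the union bound *)

Section noise_tail.
Context {R : realType}.
Variables d n : nat.
Hypothesis n_gt0 : (0 < n)%N.
Implicit Types (x v : vec R n) (W : tensor R d n).

Let tail (a : 'I_#|{: mindex d n}| -> R) (s : R) : 0 < s -> \sum_i a i ^+ 2 = 1 ->
  (gaussian_noise d n [set w | (s <= lin_form a w)%R] <=
   (expR (- (n%:R * s ^+ 2 / 4)))%:E)%E.
Proof.
move=> s0 a1; have n0 : 0 < n%:R :> R by rewrite ltr0n.
apply: (le_trans (iid_gaussian_tail _ s0 a1)); first by rewrite divr_gt0.
rewrite lee_fin ler_expR le_eqVlt; apply/orP; left; apply/eqP.
(* With v = 2 / n the exponent s^2 / (2 v) is n s^2 / 4. *)
by field; rewrite gt_eqF.
Qed.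

Lemma sum_sqr_tpow v : dot v v = 1 ->
  \sum_(i < #|{: mindex d n}|) tnth (tpow d v) i ^+ 2 = 1.
Proof. by move=> v1; rewrite -(expr1n _ d) -v1 -dot_tpow. Qed.

Let WTE (A : set (tensor R d n)) :
  WT d n A = gaussian_noise d n ((@symmetrize R d n) @^-1` A).
Proof. by []. Qed.

Lemma WT_tail_ge v (s : R) : 0 < s -> dot v v = 1 ->
  (WT d n [set W | (s <= dot (tpow d v) W)%R] <=
   (expR (- (n%:R * s ^+ 2 / 4)))%:E)%E.
Proof.
move=> s0 v1; rewrite WTE.
rewrite (_ : _ @^-1` _ = [set W | s <= lin_form (tnth (tpow d v)) W]).
  by apply: tail => //; exact: sum_sqr_tpow.
by apply/seteqP; split => W; rewrite /= dot_tpow_symmetrize.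
Qed.

Lemma WT_tail_le v (s : R) : 0 < s -> dot v v = 1 ->
  (WT d n [set W | (dot (tpow d v) W <= - s)%R] <=
   (expR (- (n%:R * s ^+ 2 / 4)))%:E)%E.
Proof.
move=> s0 v1; rewrite WTE.
(* The lower tail is the upper tail of the form with negated coefficients, whose squares still sum
   to 1. *)
rewrite (_ : _ @^-1` _ =
    [set W | s <= lin_form (fun i => - tnth (tpow d v) i) W]).
  apply: tail => //; rewrite -[RHS](sum_sqr_tpow v1).
  by under eq_bigr do rewrite sqrrN.
apply/seteqP; split => W; rewrite /= dot_tpow_symmetrize /lin_form;
  by under eq_bigr do rewrite mulNr; rewrite sumrN lerNr.
Qed.

Lemma WT_max_tail (l : seq (vec R n)) (s : R) :
  0 < s -> (forall v, v \in l -> dot v v = 1) ->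
  (WT d n [set W | scan_test l s W] <=
   ((size l)%:R * expR (- (n%:R * s ^+ 2 / 4)))%:E)%E.
Proof.
move=> s0; elim: l => [|v l IH] l1.
  rewrite mul0r (_ : [set _ | _] = set0) ?measure0//.
  by apply/seteqP; split.
rewrite (_ : [set _ | _] = [set W | s <= dot (tpow d v) W] `|`
   [set W | scan_test l s W]); last first.
  by apply/seteqP; split => W /= /orP.
apply: (le_trans (measureU2 _ _ _)).
- exact: measurable_dot_ge.
- by have := @measurable_scan_test R d n l s measurableT [set true] I; rewrite setTI.
rewrite [size _]/= -nat1r mulrDl mul1r EFinD; apply: leeD.
  by apply: WT_tail_ge => //; apply: l1; rewrite mem_head.
by apply: IH => u ul; apply: l1; rewrite in_cons ul orbT.
Qed.

End noise_tail.

(** * Product measures, expectations and exponential growth *)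

Section probability_bounds.
Context {R : realType}.

Lemma measurable_vec1 n (x : vec R n) : measurable [set x].
Proof.
rewrite (_ : [set x] = \bigcap_(i in [set: 'I_n]) [set y | tnth y i = tnth x i]).
  apply: fin_bigcap_measurable => // i _.
  have := @measurable_tnth _ R n i measurableT _ (measurable_set1 (tnth x i)).
  by rewrite setTI.
apply/seteqP; split => [y -> //|y xy].
by apply: eq_from_tnth => i; exact: xy.
Qed.

Lemma finite_vec_measurable n (A : set (vec R n)) : finite_set A -> measurable A.
Proof.
move=> Afin; rewrite -[A]image_id -(bigcup_imset1 A id).
by apply: fin_bigcup_measurable => // x _; exact: measurable_vec1.
Qed.

Lemma probability1_setC d (T : measurableType d) (P : probability T R)
    (S : set T) : measurable S -> P S = 1%E -> P (~` S) = 0%E.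
Proof. by move=> mS PS; rewrite probability_setC// PS subee. Qed.

(** The product measure integrates the measures of the sections over [P], and only sections over the
    full-mass set [S] count. *)
Lemma product_measure_section_le d1 d2 (T1 : measurableType d1)
    (T2 : measurableType d2) (P : probability T1 R) (Q : probability T2 R)
    (S : set T1) (A : set (T1 * T2)) (e : \bar R) :
  measurable S -> P S = 1%E -> measurable A ->
  (forall x, S x -> (Q [set y | A (x, y)] <= e)%E) -> (0 <= e)%E ->
  ((P \x Q) A <= e)%E.
Proof.
move=> mS PS mA Qe e0.
rewrite /product_measure1 -[leRHS]mule1 -(@probability_setT _ _ _ P).
rewrite -integral_cst//; apply: ae_ge0_le_integral => //.
  exact: measurable_fun_xsection.
exists (~` S); split; first exact: measurableC.
  exact: probability1_setC.
move=> x /= + Sx; apply => _; rewrite /comp /=.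
rewrite (_ : xsection A x = [set y | A (x, y)]) ?Qe//.
by apply/seteqP; split => y; rewrite /xsection/= inE.
Qed.

(** On [S], f >= a - (1 + a) 1_B with B = {f < a}: off B this is f >= a, on B it is f >= -1.
    Integrate. *)
Lemma expectation_ge d (T : measurableType d) (P : probability T R) (f : T -> R)
    (S : set T) (a e : R) :
  measurable_fun [set: T] f -> measurable S -> P S = 1%E ->
  (forall x, S x -> `|f x| <= 1) -> 0 <= a ->
  (P [set x | (f x < a)%R] <= e%:E)%E ->
  ((a - (1 + a) * e)%:E <= 'E_P[f])%E.
Proof.
move=> mf mS PS f1 a0 Pe.
set B := [set x | f x < a] in Pe.
have mB : measurable B.
  have := mf measurableT _ (measurable_itv `]-oo, a[); rewrite setTI.
  by congr measurable; apply/seteqP; split => x /=; rewrite in_itv.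
have -> : ('E_P[f] = \int[P]_(x in S) (f x)%:E)%E.
  rewrite unlock [RHS]integral_mkcond; apply: ae_eq_integral => //.
  - exact/measurable_EFinP.
  - by apply/(measurable_restrictT _ mS)/measurable_funTS/measurable_EFinP.
  exists (~` S); split; first exact: measurableC.
    exact: probability1_setC.
  move=> x /= + Sx; apply => _; rewrite patchE ifT//; exact/mem_set.
have Bi : P.-integrable S (fun x => ((1 + a) * \1_B x)%:E).
  apply: (integrableS measurableT) => //.
  under eq_fun do rewrite EFinM.
  by apply: integrableZl => //; exact: integrable_indic.
have ai : P.-integrable S (EFin \o cst a) by exact: finite_measure_integrable_cst.
apply: (@le_trans _ _ (\int[P]_(x in S) (a%:E - ((1 + a) * \1_B x)%:E))%E).
  have Ia : (\int[P]_(x in S) a%:E = a%:E)%E.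
    by rewrite integral_cst// [X in (_ * X)%E]PS mule1.
  rewrite (integralB_EFin mS ai Bi) [X in (X - _)%E]Ia.
  under eq_integral do rewrite EFinM.
  rewrite integralZl//; last first.
    by apply: (integrableS measurableT) => //; exact: integrable_indic.
  rewrite integral_indic// EFinB EFinM leeB// lee_wpmul2l ?lee_fin ?addr_ge0//.
  apply: le_trans Pe; apply: le_measure; rewrite ?inE//; exact: measurableI.
apply: le_integral => //.
- exact: integrableB.
- apply: measurable_bounded_integrable => //.
  + by rewrite [X in (X < _)%E]PS ltry.
  + exact: measurable_funTS.
  + exists 1; split => // M M1 x Sx /=; exact: le_trans (f1 x Sx) (ltW M1).
move=> x /set_mem Sx; rewrite -EFinB lee_fin indicE.
have := f1 x Sx; rewrite ler_norml => /andP[fN1 _].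
have [Bx|Bx] := boolP (x \in B); first by rewrite mulr1; lra.
rewrite mulr0 subr0 leNgt; apply/negP => fa; move/negP: Bx; apply.
exact/mem_set.
Qed.

Lemma cvg_expRN_natM (k : R) : 0 < k -> (fun n => expR (- (n%:R * k))) @ \oo --> 0.
Proof.
move=> k0; rewrite (_ : (fun _ => _) = GRing.exp (expR (- k))).
  by apply: cvg_expr; rewrite ger0_norm ?expR_ge0// expR_lt1 oppr_lt0.
by apply/funext => n; rewrite -expRM_natl mulrN.
Qed.

Lemma limn_esup_ln_expR (u : nat -> nat) (c k : R) :
  limn_esup (fun n => (ln (u n)%:R / n%:R)%:E) = c%:E -> c < k ->
  \forall n \near \oo, (u n)%:R <= expR (n%:R * k).
Proof.
move=> uc ck.
have : (limn_esup (fun n => (ln (u n)%:R / n%:R)%:E) < k%:E)%E by rewrite uc lte_fin.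
(* The limsup is an infimum of suprema over neighbourhoods of infinity, so one such supremum is
   already below [k]. *)
rewrite /limn_esup /limf_esup => /ereal_inf_lt[_ [V nV <-] Vk].
near=> n.
have n0 : 0 < n%:R :> R by rewrite ltr0n; near: n; exact: nbhs_infty_gt.
have /le_lt_trans/(_ Vk) : ((ln (u n)%:R / n%:R)%:E <=
    ereal_sup [set (ln (u n)%:R / n%:R : R)%:E | n in V])%E.
  by apply: ereal_sup_ubound; exists n => //; near: n; exact: nV.
rewrite lte_fin ltr_pdivrMr// => /ltW lnu.
(* The logarithm can be inverted only at positive arguments, so u n = 0 is settled apart. *)
have [->|u0] := posnP (u n); first exact: expR_ge0.
by rewrite -[leLHS]lnK ?posrE ?ltr0n// ler_expR mulrC.
Unshelve. all: by end_near. Qed.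

End probability_bounds.

(** * Error bounds under the spiked law *)

Section spiked.
Context {R : realType}.
Variables (d n : nat) (mu : probability (vec R n) R) (lambda : R).
Hypothesis n_gt0 : (0 < n)%N.
Hypothesis mu_fin : finitely_supported mu.
Hypothesis mu_unit : supp mu `<=` [set x | norm2 x = 1].

Let l : seq (vec R n) := fset_set (supp mu).

Lemma mem_suppE x : (x \in l) = (x \in supp mu).
Proof. by rewrite /l in_fset_set//; case: mu_fin. Qed.

Lemma supp_unit x : x \in l -> dot x x = 1.
Proof. by rewrite mem_suppE inE => /mu_unit; exact: norm2_eq1. Qed.

(** Conditioning on the spike: x and W are independent, so it is enough to cover, for each fixed x
    in the support, the bad event by an event [B x] of the noise alone. *)
Lemma spiked_joint_le (A : set (vec R n * tensor R d n))
    (B : vec R n -> set (tensor R d n)) (e : \bar R) :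
  measurable A -> (forall x, measurable (B x)) -> (0 <= e)%E ->
  (forall x W, x \in l -> A (x, spike lambda x W) -> B x W) ->
  (forall x, x \in l -> (WT d n (B x) <= e)%E) ->
  (spiked_joint d lambda mu A <= e)%E.
Proof.
move=> mA mB e0 AB Be; case: mu_fin => fin mu1.
have -> : spiked_joint d lambda mu A =
  (mu \x WT d n)%E ((@signal_sample R d n lambda) @^-1` A) by [].
have mA' : measurable ((@signal_sample R d n lambda) @^-1` A).
  by rewrite -[X in measurable X]setTI; apply: measurable_funPT.
apply: (product_measure_section_le (finite_vec_measurable fin) mu1) => //.
move=> x Sx; have xl : x \in l by rewrite mem_suppE inE.
apply: le_trans (Be x xl); apply: le_measure; rewrite ?inE//.
  have := measurable_xsection x mA'; congr measurable.
  by apply/seteqP; split => W; rewrite /xsection /= inE.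
by move=> W; exact: AB.
Qed.

Lemma scan_test_miss (t : R) : t < lambda ->
  (spiked_WT d lambda mu [set T | scan_test l t T = false] <=
   (expR (- (n%:R * (lambda - t) ^+ 2 / 4)))%:E)%E.
Proof.
move=> tl.
have -> : spiked_WT d lambda mu [set T | scan_test l t T = false] =
  spiked_joint d lambda mu [set p | scan_test l t p.2 = false] by [].
apply: (@spiked_joint_le _
    (fun x => [set W | dot (tpow d x) W <= - (lambda - t)])).
- have := @measurable_scan_test R d n l t measurableT [set false] I.
  rewrite setTI => mS; rewrite -[X in measurable X]setTI.
  exact: (@measurable_snd _ _ (vec R n) (tensor R d n) measurableT _ mS).
- by move=> x; exact: measurable_dot_le.
- by rewrite lee_fin expR_ge0.
(* If no candidate passes, the spike fails in particular; hence no union bound here. *)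
- move=> x W xl /= /negbT /hasPn /(_ _ xl).
  rewrite dot_tpow_spike (supp_unit xl) expr1n -ltNge; lra.
- by move=> x xl; apply: WT_tail_le; rewrite ?subr_gt0//; exact: supp_unit.
Qed.

Lemma measurable_overlap x0 (t : R) :
  measurable_fun [set: vec R n * tensor R d n]
    (fun p => dot p.1 (first_hit x0 l t p.2) ^+ d).
Proof.
apply: measurable_funX; apply: measurable_sum => i; apply: measurable_funM.
  apply: (measurableT_comp (f := fun x : vec R n => tnth x i)).
    exact: measurable_tnth.
  exact: measurable_fst.
apply: (measurableT_comp
    (f := fun T : tensor R d n => tnth (first_hit x0 l t T) i)).
  apply: (measurableT_comp (f := fun x : vec R n => tnth x i)).
    exact: measurable_tnth.
  exact: measurable_first_hit.
exact: measurable_snd.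
Qed.

Lemma first_hit_miss (t s : R) x0 : 0 < lambda -> t < lambda -> 0 < s ->
  (spiked_joint d lambda mu
    [set p | (dot p.1 (first_hit x0 l t p.2) ^+ d < (t - s) / lambda)%R] <=
   ((size l)%:R * expR (- (n%:R * s ^+ 2 / 4)) +
    expR (- (n%:R * (lambda - t) ^+ 2 / 4)))%:E)%E.
Proof.
move=> l0 tl s0.
have ms : measurable [set W : tensor R d n | scan_test l s W].
  have := @measurable_scan_test R d n l s measurableT [set true] I.
  by rewrite setTI.
apply: (@spiked_joint_le _
    (fun x => [set W | scan_test l s W] `|`
              [set W | dot (tpow d x) W <= - (lambda - t)])).
- have := measurable_overlap x0 t measurableT (measurable_itv `]-oo, (t - s) / lambda[).
  by rewrite setTI; congr measurable; apply/seteqP; split => x /=; rewrite in_itv.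
- by move=> x; apply: measurableU => //; exact: measurable_dot_le.
- by rewrite lee_fin addr_ge0 ?mulr_ge0 ?expR_ge0.
- move=> x W xl /=; rewrite ltNge; move/negP; apply: contra_notP => /not_orP[sW xW].
  apply: first_hit_correlated => //; [exact: supp_unit|exact/negP|exact/negP].
move=> x xl; rewrite EFinD; apply: le_trans (measureU2 _ _ _) _ => //.
  exact: measurable_dot_le.
apply: leeD; first by apply: WT_max_tail => // v; exact: supp_unit.
by apply: WT_tail_le; rewrite ?subr_gt0//; exact: supp_unit.
Qed.

Lemma first_hit_expectation (t s : R) x0 :
  0 < lambda -> t < lambda -> 0 < s -> s <= t -> x0 \in l ->
  (((t - s) / lambda - (1 + (t - s) / lambda) *
    ((size l)%:R * expR (- (n%:R * s ^+ 2 / 4)) +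
      expR (- (n%:R * (lambda - t) ^+ 2 / 4))))%:E <=
  'E_(spiked_joint d lambda mu)
     [fun p => (dot p.1 (first_hit x0 l t p.2) ^+ d)%R])%E.
Proof.
move=> l0 tl s0 st x0l; case: (mu_fin) => fin mu1.
(* On this set the spike and the estimate are both unit vectors, so the overlap is at most 1 in
   absolute value. *)
apply: (@expectation_ge _ _ _ _ _ (supp mu `*` setT)).
- exact: measurable_overlap.
- by apply: measurableX => //; exact: finite_vec_measurable.
- have -> : spiked_joint d lambda mu (supp mu `*` setT) =
    (mu \x WT d n)%E (supp mu `*` setT).
    congr ((mu \x WT d n)%E _); apply/seteqP; split => -[].
  rewrite product_measure1E//; last exact: finite_vec_measurable.
  by rewrite [X in (X * _)%E]mu1 [X in (_ * X)%E](probability_setT (WT d n)) mule1.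
- move=> [x T] [/= Sx _]; rewrite normrX exprn_ile1// dot_unit_le1//.
    by apply: supp_unit; rewrite mem_suppE inE.
  by apply: supp_unit; exact: mem_first_hit.
- by rewrite divr_ge0 ?subr_ge0// ltW.
exact: first_hit_miss.
Qed.

End spiked.

(** * Vanishing of the error and conclusion *)

Lemma cvg_error_bound (R : realType) (u : nat -> nat) (c s r : R) :
  limn_esup (fun n => (ln (u n)%:R / n%:R)%:E) = c%:E ->
  c < s ^+ 2 / 4 -> 0 < r ->
  (fun n => (u n)%:R * expR (- (n%:R * s ^+ 2 / 4)) +
            expR (- (n%:R * r ^+ 2 / 4))) @ \oo --> (0 : R).
Proof.
move=> uc cs r0; rewrite -[X in _ --> X]addr0.
apply: cvgD; last first.
  under eq_fun do rewrite -mulrA.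
  by apply: cvg_expRN_natM; rewrite divr_gt0 ?exprn_gt0.
(* A rate strictly between c and s^2/4: eventually u n <= exp(n k), and exp(-n (s^2/4 - k)) still
   decays. *)
pose k := (c + s ^+ 2 / 4) / 2.
have ck : c < k by rewrite /k; lra.
have ks : 0 < s ^+ 2 / 4 - k by rewrite /k; lra.
have ukn := limn_esup_ln_expR uc ck.
apply: (squeeze_cvgr _ (cvg_cst 0) (cvg_expRN_natM ks)).
near=> n; rewrite mulr_ge0 ?expR_ge0//=.
have -> : - (n%:R * (s ^+ 2 / 4 - k)) = n%:R * k + - (n%:R * s ^+ 2 / 4) by ring.
rewrite expRD ler_wpM2r ?expR_ge0//; near: n; exact: ukn.
Unshelve. all: by end_near. Qed.

Theorem proposition4p1 (R : realType)
    (X : forall n : nat, probability (vec R n) R) (c : R)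
    (X_prior : finite_prior X)
    (X_exp : limn_esup (fun n : nat => (ln (supp_size (X n))%:R / n%:R)%:E) = c%:E)
    (d : nat) (d_ge2 : (2 <= d)%N)
    (lambda : R) (lambda_gt : 2 * Num.sqrt c < lambda) :
  strong_detection (fun n => WT d n) (fun n => spiked_WT d lambda (X n)) /\
  weak_recovery d lambda X.
Proof.
have sc0 := sqrtr_ge0 c.
(* [s] and [t] cut the interval from 2 sqrt c to lambda into three equal parts. *)
pose s := (2 * Num.sqrt c * 2 + lambda) / 3.
pose t := (2 * Num.sqrt c + lambda * 2) / 3.
have s_gt : 2 * Num.sqrt c < s by rewrite /s; lra.
have st : s < t by rewrite /s /t; lra.
have tl : t < lambda by rewrite /t; lra.
have s0 : 0 < s by lra.
have l0 : 0 < lambda by lra.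
have cs : c < s ^+ 2 / 4.
  (* For negative c, [Num.sqrt c] does not square to c, but the right-hand side is positive. *)
  have [c0|c0] := ltP c 0; first by rewrite (lt_trans c0)// divr_gt0 ?exprn_gt0.
  rewrite -{1}(sqr_sqrtr c0); nra.
have lt0 : 0 < lambda - t by rewrite subr_gt0.
have err0 := cvg_error_bound X_exp cs lt0.
set err := (X in X @ _ --> _) in err0.
pose l n : seq (vec R n) := fset_set (supp (X n)).
split.
  exists (fun n => scan_test (l n) t); first by move=> n; exact: measurable_scan_test.
  have err0E : (fun n => (err n)%:E) @ \oo --> 0%E.
    by apply/fine_cvgP; split; [exact: nearW|].
  apply: (squeeze_cvge _ (cvg_cst 0%E) err0E).
  near=> n.
  have n0 : (0 < n)%N by near: n; exact: nbhs_infty_gt.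
  have [fin_n unit_n] := X_prior n n0.
  rewrite adde_ge0 ?mule_ge0//=.
  rewrite /err EFinD; apply: leeD.
    apply: le_trans (gee_pMl _ _ _) _ => //; first by rewrite lee_fin; lra.
    have t0 : 0 < t by lra.
    have l1 v : v \in l n -> dot v v = 1 by exact: supp_unit.
    (* A false alarm is pure noise reaching t; the bound at t is weakened to the one at s < t to
       match [err]. *)
    apply: le_trans (WT_max_tail d n0 t0 l1) _.
    rewrite lee_fin ler_wpM2l// ler_expR lerN2 ler_pM2r// ler_wpM2l//.
    by rewrite ler_pXn2r ?nnegrE ?ltW.
  apply: le_trans (gee_pMl _ _ _) _ => //; first by rewrite lee_fin; lra.
  exact: scan_test_miss.
exists (fun n => first_hit (head [tuple of nseq n 0] (l n)) (l n) t).
have x0l n : (0 < n)%N -> head [tuple of nseq n 0] (l n) \in l n.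
  move=> n0; have [[fin_n X1] _] := X_prior n n0.
  have : l n != [::].
    apply/eqP => l_nil; move: X1.
    rewrite (_ : supp (X n) = set0).
      by rewrite measure0 => /eqP; rewrite eqe eq_sym oner_eq0.
    apply/seteqP; split => // x xs.
    by have := mem_suppE (X_prior n n0).1 x; rewrite -/(l n) l_nil mem_set.
  by case: (l n) => [//|x s'] _; exact: mem_head.
split; first by move=> n; exact: measurable_first_hit.
split.
  move=> n T n0; have [fin_n unit_n] := X_prior n n0.
  apply: unit_n; have := mem_first_hit t T (x0l n n0).
  by rewrite mem_suppE// inE.
have a0 : 0 < (t - s) / lambda by rewrite divr_gt0 ?subr_gt0.
exists ((t - s) / lambda / 2); first by rewrite divr_gt0.
(* With a = (t - s)/lambda, this tolerance gives (1 + a) err_n <= a/2, leaving a mean overlap of at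
   least a/2. *)
move/cvgrPdist_le : err0 => /(_ ((t - s) / lambda / 2 / (1 + (t - s) / lambda))) err0.
near=> n.
have n0 : (0 < n)%N by near: n; exact: nbhs_infty_gt.
have [fin_n unit_n] := X_prior n n0.
apply: le_trans (first_hit_expectation d n0 fin_n unit_n l0 tl s0 (ltW st) (x0l n n0)).
have : `|0 - err n| <= (t - s) / lambda / 2 / (1 + (t - s) / lambda).
  near: n; apply: err0; rewrite !divr_gt0//; lra.
rewrite sub0r normrN => /(le_trans (ler_norm _)).
rewrite -[X in _ -> (_ <= (_ - _ * X)%:E)%E]/(err n) ler_pdivlMr; last by lra.
by rewrite lee_fin; lra.
Unshelve. all: by end_near. Qed.
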